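(* Let $(W,S)$ be a finite Coxeter system and let $A\subseteq T$. Suppose there exist two subsets $S_1,S_2\subseteq S$ such that $A=S_1\cup\bigl(\bigcup_{s\in S_2}C(s)\bigr)$, where $C(s)$ denotes the conjugacy class of $s$ in $W$. Then $\mathcal{D}_A(W)$ is a subalgebra of $\mathbb{Z}W$.
   Context: $\ell:W\to\mathbb{N}$ is the length function of $(W,S)$ and $T=\{wsw^{-1}\mid w\in W,\ s\in S\}$ is the set of reflections. For $A\subseteq T$ and $w\in W$, the $A$-descent set is $D_A(w)=\{r\in A\mid \ell(wr)<\ell(w)\}$. A subset $I\subseteq A$ is $A$-admissible if $I=D_A(w)$ for some $w\in W$; $\mathcal{P}_{\mathrm{ad}}(A)$ is the set of $A$-admissible subsets. For $I\in\mathcal{P}_{\mathrm{ad}}(A)$ put $D_I^A=\{w\in W\mid D_A(w)=I\}$ and $d_I^A=\sum_{w\in D_I^A}w\in\mathbb{Z}W$. Then $\mathcal{D}_A(W)=\bigoplus_{I\in\mathcal{P}_{\mathrm{ad}}(A)}\mathbb{Z}d_I^A$, a $\mathbb{Z}$-submodule of the group ring $\mathbb{Z}W$. A subalgebra here need not contain $1$. *)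

(* Defs.v *)
From HB Require Import structures.
From mathcomp Require Import all_boot all_order all_algebra all_fingroup.

Set Implicit Arguments.
Unset Strict Implicit.
Unset Printing Implicit Defensive.

Import GRing.Theory.
Local Open Scope ring_scope.

(* An alias, so that the product is convolution: {ffun G -> R} itself
   canonically carries the pointwise product. *)
Definition groupRing (R : comNzRingType) (G : finGroupType) : predArgType :=
  {ffun G -> R}.

Section GroupRing.
Variables (R : comNzRingType) (G : finGroupType).
Implicit Types (x y z : groupRing R G) (a b : R) (g h : G).

HB.instance Definition _ :=
  GRing.Zmodule.copy (groupRing R G) {ffun G -> R}.

Definition gr_elt g : groupRing R G := [ffun h => (h == g)%:R].

Definition gr_mul x y : groupRing R G :=
  [ffun g => \sum_h x h * y (h^-1 * g)%g].

Definition gr_scale a x : groupRing R G := [ffun g => a * x g].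

Fact gr_mulA : associative gr_mul.
Proof.
move=> x y z; apply/ffunP=> g; rewrite !ffunE.
under eq_bigr => h _ do rewrite ffunE mulr_sumr.
under [RHS]eq_bigr => h _ do rewrite ffunE mulr_suml.
rewrite [RHS]exchange_big; apply: eq_bigr => k _ /=.
rewrite (reindex_inj (mulgI k^-1%g)); apply: eq_bigr => h _ /=.
by rewrite mulrA invMg invgK -mulgA mulKVg.
Qed.

Fact gr_mul1 : left_id (gr_elt 1%g) gr_mul.
Proof.
move=> x; apply/ffunP=> g; rewrite ffunE (bigD1 1%g) //= big1 ?addr0.
  by rewrite ffunE eqxx mul1r invg1 mul1g.
by move=> h /negPf nh1; rewrite ffunE nh1 mul0r.
Qed.

Fact gr_mulr1 : right_id (gr_elt 1%g) gr_mul.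
Proof.
move=> x; apply/ffunP=> g; rewrite ffunE (bigD1 g) //= big1 ?addr0.
  by rewrite ffunE mulVg eqxx mulr1.
move=> h /negPf nhg; rewrite ffunE.
by rewrite -(inj_eq (mulgI h)) mulKVg mulg1 eq_sym nhg mulr0.
Qed.

Fact gr_mulDl : left_distributive gr_mul +%R.
Proof.
move=> x y z; apply/ffunP=> g; rewrite !ffunE -big_split.
by apply: eq_bigr => h _; rewrite ffunE mulrDl.
Qed.

Fact gr_mulDr : right_distributive gr_mul +%R.
Proof.
move=> x y z; apply/ffunP=> g; rewrite !ffunE -big_split.
by apply: eq_bigr => h _; rewrite ffunE mulrDr.
Qed.

Fact gr_oner_neq0 : gr_elt 1%g != 0.
Proof.
apply/eqP=> /ffunP/(_ 1%g); rewrite !ffunE eqxx.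
exact/eqP/oner_neq0.
Qed.

HB.instance Definition _ := GRing.Zmodule_isNzRing.Build (groupRing R G)
  gr_mulA gr_mul1 gr_mulr1 gr_mulDl gr_mulDr gr_oner_neq0.

Fact gr_scaleA a b x : gr_scale a (gr_scale b x) = gr_scale (a * b) x.
Proof. by apply/ffunP=> g; rewrite !ffunE mulrA. Qed.

Fact gr_scale1 : left_id 1 gr_scale.
Proof. by move=> x; apply/ffunP=> g; rewrite ffunE mul1r. Qed.

Fact gr_scaleDr : right_distributive gr_scale +%R.
Proof. by move=> a x y; apply/ffunP=> g; rewrite !ffunE mulrDr. Qed.

Fact gr_scaleDl x : {morph gr_scale^~ x : a b / a + b}.
Proof. by move=> a b; apply/ffunP=> g; rewrite !ffunE mulrDl. Qed.

HB.instance Definition _ := GRing.Zmodule_isLmodule.Build R (groupRing R G)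
  gr_scaleA gr_scale1 gr_scaleDr gr_scaleDl.

Fact gr_scaleAl a x y : a *: (x * y) = (a *: x) * y.
Proof.
apply/ffunP=> g; rewrite !ffunE mulr_sumr.
by apply: eq_bigr => h _; rewrite ffunE mulrA.
Qed.

HB.instance Definition _ :=
  GRing.Lmodule_isLalgebra.Build R (groupRing R G) gr_scaleAl.

Fact gr_scaleAr a x y : a *: (x * y) = x * (a *: y).
Proof.
apply/ffunP=> g; rewrite !ffunE mulr_sumr.
by apply: eq_bigr => h _; rewrite ffunE mulrCA.
Qed.

HB.instance Definition _ :=
  GRing.Lalgebra_isAlgebra.Build R (groupRing R G) gr_scaleAr.

Lemma gr_eltM g h : gr_elt (g * h)%g = gr_elt g * gr_elt h.
Proof.
apply/ffunP=> k; rewrite !ffunE (bigD1 g) //= big1 ?addr0.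
  by rewrite !ffunE eqxx mul1r -[in RHS](inj_eq (mulgI g)) mulKVg.
by move=> l /negPf nlg; rewrite ffunE nlg mul0r.
Qed.

Lemma gr_sumE (I : Type) (r : seq I) (P : pred I) (F : I -> groupRing R G) g :
  (\sum_(i <- r | P i) F i) g = \sum_(i <- r | P i) F i g.
Proof. by apply: (big_morph (fun x => x g)) => [x y|]; rewrite ffunE. Qed.

End GroupRing.

(* A subalgebra need not contain 1. *)
Definition is_subalgebra (R : comNzRingType) (E : algType R) (D : E -> Prop)
    : Prop :=
  [/\ D 0,
      forall (a : R) (x y : E), D x -> D y -> D (a *: x + y)
    & forall x y : E, D x -> D y -> D (x * y)].

(* W is generated by the involutions in S, subject only to the relations
   (s t)^m(s,t) = 1 with m(s,t) the order of s t; the presentation is expressed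
   by its universal property.  All the orders m(s,t) are finite, as W is. *)
Record coxeterSystem (W : finGroupType) := CoxeterSystem {
  cox_gens :> {set W};
  cox_order2 : forall s, s \in cox_gens -> #[s]%g = 2%N;
  cox_gen : <<cox_gens>>%g = [set: W];
  cox_pres : forall (H : groupType) (f : W -> H),
    (forall s t, s \in cox_gens -> t \in cox_gens ->
       ((f s * f t) ^+ #[s * t] = 1)%g) ->
    exists2 phi : W -> H,
      {morph phi : x y / (x * y)%g} & forall s, s \in cox_gens -> phi s = f s
}.

Section Coxeter.
Variables (W : finGroupType) (S : coxeterSystem W).
Implicit Types (w s r : W) (A I : {set W}) (n : nat).

Definition has_word w n : bool :=
  [exists t : n.-tuple W, all [in cox_gens S] t && (w == \prod_(s <- t) s)%g].

Fact has_word_ex w : exists n, has_word w n.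
Proof.
have /gen_prodgP[n [c cS ->]] : w \in <<cox_gens S>>%g by rewrite cox_gen inE.
exists n; apply/existsP; exists [tuple c i | i < n].
apply/andP; split; first by apply/allP=> _ /mapP[i _ ->]; apply: cS.
by rewrite big_tuple; apply/eqP/eq_bigr => i _; rewrite tnth_mktuple.
Qed.

Definition ell w : nat := ex_minn (has_word_ex w).

Definition reflections : {set W} :=
  [set (w * s * w^-1)%g | w in [set: W], s in cox_gens S].

Definition descents A w : {set W} := [set r in A | (ell (w * r)%g < ell w)%N].

Definition admissible A : {set {set W}} := [set descents A w | w : W].

Definition descent_class A I : {set W} := [set w | descents A w == I].

Definition descent_elt A I : groupRing int W :=
  \sum_(w in descent_class A I) gr_elt int w.

(* The Z-span of the d_I; the sum is direct by [descent_elt_free]. *)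
Definition descent_module A (x : groupRing int W) : Prop :=
  exists c : {set W} -> int,
    x = \sum_(I in admissible A) c I *: descent_elt A I.

Lemma descent_eltE A I w : descent_elt A I w = (descents A w == I)%:R.
Proof.
rewrite /descent_elt gr_sumE; under eq_bigr => v _ do rewrite ffunE.
have [dw|dw] := boolP (_ == I).
  rewrite (bigD1 w) ?inE //= eqxx big1 ?addr0 // => v /andP[_].
  by rewrite eq_sym => /negPf->.
rewrite big1 // => v; rewrite inE => dv.
by case: eqP => // wv; rewrite wv dv in dw.
Qed.

Lemma descent_elt_free A (c : {set W} -> int) :
  \sum_(I in admissible A) c I *: descent_elt A I = 0 ->
  forall I, I \in admissible A -> c I = 0.
Proof.
move=> c0 I adI; have /imsetP[w _ wI] := adI.
have /ffunP/(_ w) := c0; rewrite gr_sumE (bigD1 I) //= big1 ?addr0.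
  by rewrite !ffunE descent_eltE wI eqxx mulr1.
by move=> J /andP[_ /negPf nJI]; rewrite ffunE descent_eltE -wI eq_sym nJI mulr0.
Qed.

End Coxeter.

(* Main.v *)
Require Import Defs.
From mathcomp Require Import all_boot all_order all_algebra all_fingroup.

(** [N w t], for a reflection [t], records whether [t] is an inversion of [w];
    it is a cocycle, N (x y) t = N y t + N x (y t y^-1) mod 2, obtained by letting
    W act on W x {+1, -1} as in Bourbaki.  Elements with the same A-descent set
    are joined by steps g -> s g, with s simple and g^-1 s g not in A.  Along such
    a step the factorizations g = h k and s g = h' k' correspond bijectively,
    preserving the A-descents of both factors: take (h', k') = (s h, k) if
    t = h^-1 s h is not in A, and (h', k') = (h, t k) otherwise.  In the latter
    case k^-1 t k = g^-1 s g is not in A, so t lies in no conjugacy class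
    contained in A, hence t is simple and t k has the same A-descents as k. *)

Set Implicit Arguments.
Unset Strict Implicit.
Unset Printing Implicit Defensive.

Import GRing.Theory.
Local Open Scope group_scope.

(** * The signed conjugation action *)

Section FlipAction.
Variable G : finGroupType.
Implicit Types (r s t : G) (z : G * bool).

(** Conjugation is on the right to match the left-to-right product of permutations; acting on all of
    [G] spares a separate type of reflections. *)
Definition flip s z : G * bool := (z.1 ^ s, z.2 (+) (z.1 == s)).

Fact flip_inj s : injective (flip s).
Proof.
by move=> [r e] [r' e'] [/conjg_inj-> /=] /(canRL (addbK _)); rewrite addbK => ->.
Qed.

Definition flip_perm s : {perm G * bool} := perm (@flip_inj s).

(* The letter in position j (even for s, odd for t) of the word s t s t ...
   flips r exactly when r is that letter conjugated back through the j letters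
   before it, which is (s t)^j s. *)
Lemma flip_permX s t n r e : s ^+ 2 = 1 -> t ^+ 2 = 1 ->
  ((flip_perm s * flip_perm t) ^+ n) (r, e) =
    (r ^ ((s * t) ^+ n),
     e (+) \big[addb/false]_(0 <= j < n.*2) (r == (s * t) ^+ j * s)).
Proof.
move=> ss tt.
have sV : s^-1 = s by apply/eqP; rewrite eq_invg_mul; apply/eqP.
have tV : t^-1 = t by apply/eqP; rewrite eq_invg_mul; apply/eqP.
have swap k : s * ((s * t) ^+ k)^-1 = (s * t) ^+ k * s.
  rewrite -expgVn invMg sV tV; elim: k => [|k IHk]; first by rewrite mulg1 mul1g.
  by rewrite !expgSr !mulgA IHk.
elim: n => [|n IHn].
  by rewrite perm1 conjg1 big_geq // addbF.
rewrite expgSr permM IHn permM !permE /flip /= doubleS !big_nat_recr //=.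
congr (_, _); first by rewrite -!conjgM -expgSr.
rewrite -!addbA; congr (_ (+) (_ (+) (_ (+) _))).
  rewrite -(inj_eq (conjg_inj ((s * t) ^+ n)^-1)) conjgK.
  by rewrite conjgE invgK swap mulgA -expgD addnn.
rewrite -conjgM -(inj_eq (conjg_inj ((s * t) ^+ n * s)^-1)) conjgK.
rewrite conjgE invgK invMg sV -!mulgA swap !mulgA.
by rewrite -(mulgA _ s t) -expgSr -expgD addSn addnn.
Qed.

(** Positions [j] and [j + #[s * t]] carry the same element [(s * t) ^+ j * s], so each sign is
    flipped an even number of times. *)
Lemma flip_perm_order s t : s ^+ 2 = 1 -> t ^+ 2 = 1 ->
  (flip_perm s * flip_perm t) ^+ #[s * t] = 1.
Proof.
move=> ss tt; apply/permP=> -[r e]; rewrite flip_permX // expg_order conjg1 perm1.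
congr (_, _); rewrite -addnn (@big_cat_nat _ _ _ #[s * t]) ?leq_addr //=.
rewrite -{2}[#[s * t]]add0n big_addn addnK.
under [X in _ (+) (_ (+) X)]eq_bigr => j _ do rewrite expgD expg_order mulg1.
by rewrite addbb addbF.
Qed.

End FlipAction.

(** * Length and the inversion cocycle *)

Section Cocycle.
Variables (W : finGroupType) (S : coxeterSystem W).
Implicit Types (w x y s t : W) (A : {set W}).

Lemma cox_sq1 s : s \in cox_gens S -> s ^+ 2 = 1.
Proof. by move=> /cox_order2 <-; rewrite expg_order. Qed.

Lemma cox_gensV s : s \in cox_gens S -> s^-1 = s.
Proof. by move=> /cox_sq1 ss; apply/eqP; rewrite eq_invg_mul; apply/eqP. Qed.

Lemma cox_mulgK w s : s \in cox_gens S -> w * s * s = w.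
Proof. by move=> /cox_gensV sV; rewrite -{1}sV mulgKV. Qed.

Lemma has_wordS w n s : s \in cox_gens S -> has_word S w n ->
  has_word S (w * s) n.+1.
Proof.
move=> sS /existsP[c /andP[cS /eqP->]]; apply/existsP.
exists [tuple of rcons c s]; rewrite all_rcons big_rcons /= cS andbT.
by apply/andP.
Qed.

Lemma has_word_rcons w n : has_word S w n.+1 ->
  exists x s, [/\ s \in cox_gens S, has_word S x n & w = x * s].
Proof.
case/existsP=> c /andP[cS /eqP->].
case: c cS => c /= /eqP; case/lastP: c => // c s; rewrite size_rcons.
move=> [sz]; rewrite all_rcons => /andP[sS cS].
exists (\prod_(i <- c) i), s; split=> //; last by rewrite big_rcons.
apply/existsP; exists (tcast sz (in_tuple c)).
by rewrite val_tcast cS /=.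
Qed.

Lemma ell_word w : has_word S w (ell S w).
Proof. by rewrite /ell; case: ex_minnP. Qed.

Lemma ell_min w n : has_word S w n -> ell S w <= n.
Proof. by rewrite /ell; case: ex_minnP => m _; apply. Qed.

Lemma ell_mul_gen w s : s \in cox_gens S -> ell S (w * s) <= (ell S w).+1.
Proof. by move=> sS; apply/ell_min/has_wordS/ell_word. Qed.

Lemma ell_eq0 w : ell S w = 0 -> w = 1.
Proof.
move=> w0; have := ell_word w; rewrite w0 => /existsP[c /andP[_ /eqP->]].
by rewrite (tuple0 c) big_nil.
Qed.

Lemma ell_rcons w n : ell S w = n.+1 ->
  exists x s, [/\ s \in cox_gens S, ell S x = n & w = x * s].
Proof.
move=> wn; have := ell_word w; rewrite wn => /has_word_rcons[x [s [sS /ell_min xn ws]]].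
exists x, s; split=> //; apply/eqP; rewrite eqn_leq xn -ltnS -wn ws.
exact: ell_mul_gen.
Qed.

Lemma gen_in_reflections s : s \in cox_gens S -> s \in reflections S.
Proof.
by move=> sS; apply/imset2P; exists 1 s; rewrite ?inE // invg1 mulg1 mul1g.
Qed.

Lemma inversion_cocycle : exists N : W -> W -> bool,
  (forall x y t, N (x * y) t = N y t (+) N x (t ^ y^-1)) /\
  (forall s t, s \in cox_gens S -> N s t = (t == s)).
Proof.
have [|phi phiM phiS] := @cox_pres W S {perm W * bool} (@flip_perm W).
  by move=> s t /cox_sq1 ss /cox_sq1 tt; apply: flip_perm_order.
have phi1 : phi 1 = 1 by apply: (mulgI (phi 1)); rewrite -phiM !mulg1.
have phiE w : exists n : W -> bool, forall t e, phi w (t, e) = (t ^ w, e (+) n t).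
  have [k] := has_word_ex S w; elim: k w => [|k IHk] w.
    move=> /existsP[c /andP[_ /eqP->]]; rewrite (tuple0 c) big_nil phi1.
    by exists xpred0 => t e; rewrite perm1 conjg1 addbF.
  move=> /has_word_rcons[x [s [sS /IHk[n xn] ->]]].
  exists (fun t => n t (+) (t ^ x == s)) => t e.
  by rewrite phiM permM xn phiS // permE /flip /= conjgM addbA.
(* Taking [w^-1] in this right action makes the factor [y] of [x * y] act first, as the cocycle rule
   demands. *)
exists (fun w t => (phi w^-1 (t, false)).2); split=> [x y t | s t sS].
  have [nx xE] := phiE x^-1; have [ny yE] := phiE y^-1.
  by rewrite invMg phiM permM yE !xE.
by rewrite cox_gensV // phiS // permE.
Qed.

(** * Strong exchange and descent sets *)

Section Inversions.
Variable N : W -> W -> bool.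
Hypothesis NM : forall x y t, N (x * y) t = N y t (+) N x (t ^ y^-1).
Hypothesis NS : forall s t, s \in cox_gens S -> N s t = (t == s).

Lemma cocycle1 t : N 1 t = false.
Proof. by have := NM 1 1 t; rewrite mulg1 invg1 conjg1; case: (N 1 t). Qed.

(** For [t = u * s * u^-1] the contributions of [u] and [u^-1] cancel because [N 1] vanishes,
    leaving [N s s]. *)
Lemma cocycle_reflection t : t \in reflections S -> N t t.
Proof.
case/imset2P=> u s _ sS ->.
have tE : u * s * u^-1 = s ^ u^-1 by rewrite conjgE invgK mulgA.
have := cocycle1 (s ^ u^-1); rewrite -(mulgV u) NM invgK conjgKV => Nu.
rewrite {2}tE NM invgK conjgKV NM (NS _ sS) eqxx.
by rewrite (cox_gensV sS) [s ^ s]conjgE mulKg; case: (N _ _) Nu; case: (N _ _).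
Qed.

(** Strong exchange: strip the last letter [s] of a reduced word of [w]; either [t = s], or
    [t ^ s^-1] is an inversion of the shorter element. *)
Lemma cocycle_exchange w t : N w t -> ell S (w * t) < ell S w.
Proof.
have [n wn] : exists n, ell S w = n by exists (ell S w).
elim: n w t wn => [|n IHn] w t wn; first by rewrite (ell_eq0 wn) cocycle1.
have [x [s [sS xn ws]]] := ell_rcons wn.
rewrite wn ws NM (NS _ sS); case: eqP => [-> _ | _ /=].
  by rewrite (cox_mulgK _ sS) xn.
move=> /(IHn x _ xn) lt_x.
have -> : x * s * t = x * t ^ s^-1 * s by rewrite conjgE invgK !mulgA mulgKV.
by apply: leq_ltn_trans (ell_mul_gen _ sS) _; rewrite ltnS -xn.
Qed.

(** If [N w t] fails then [N (w * t) t] holds, and exchange applied to [w * t] gives the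
    converse. *)
Lemma ell_ltE w t : t \in reflections S -> (ell S (w * t) < ell S w) = N w t.
Proof.
move=> tT; apply/idP/idP; last exact: cocycle_exchange.
apply: contraTT => Nwt; rewrite -leqNgt ltnW //.
have tt : t * t = 1.
  case/imset2P: tT => u s _ sS ->.
  by rewrite !mulgA mulgKV (cox_mulgK _ sS) mulgV.
rewrite -{1}[w]mulg1 -tt mulgA cocycle_exchange // NM cocycle_reflection //.
by rewrite conjgE invgK mulgV mulg1 addTb.
Qed.

Variable A : {set W}.
Hypothesis sAT : A \subset reflections S.

Lemma mem_descents w t : (t \in descents S A w) = (t \in A) && N w t.
Proof.
by rewrite inE; case: (boolP (t \in A)) => //= /(subsetP sAT)/ell_ltE->.
Qed.

(** By the cocycle rule, [N (s * w)] and [N w] differ only at [s ^ w]. *)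
Lemma descents_gen_mul s w : s \in cox_gens S -> s ^ w \notin A ->
  descents S A (s * w) = descents S A w.
Proof.
move=> sS swA; apply/setP=> t; rewrite !mem_descents NM (NS _ sS).
have [tA /= | //] := boolP (t \in A).
case: eqP => [ts | _]; last by rewrite addbF.
by rewrite -ts conjgKV tA in swA.
Qed.

(* The steps are those of a minimal gallery from w to w'. *)
Lemma descents_ind (P : W -> W -> Prop) :
  (forall w, P w w) ->
  (forall s w w', s \in cox_gens S -> s ^ w \notin A -> P (s * w) w' -> P w w') ->
  forall w w', descents S A w = descents S A w' -> P w w'.
Proof.
move=> P0 PS w w'; have [n] : exists n, ell S (w' * w^-1) = n by eexists.
elim: n w => [|n IHn] w wn dw.
  by have /eqP := ell_eq0 wn; rewrite -eq_mulgV1 => /eqP->.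
have [x [s [sS xn ws]]] := ell_rcons wn.
have w'E : w' = x * s * w by rewrite -ws mulgKV.
(* As [x * s] is longer than [x], [N w] and [N w'] differ at [s ^ w], which equal descent sets
   forbid in [A]. *)
have swA : s ^ w \notin A.
  apply/negP=> swA; have /setP/(_ (s ^ w)) := dw.
  rewrite !mem_descents swA w'E /= NM conjgK.
  rewrite -[N (x * s) s]ell_ltE ?gen_in_reflections //.
  rewrite (cox_mulgK _ sS) -ws wn xn ltnSn.
  by case: (N w _).
apply: (PS s) => //; apply: IHn; last by rewrite descents_gen_mul.
by rewrite w'E invMg -!mulgA mulKVg mulgV mulg1.
Qed.

End Inversions.

(** The spanning elements are the indicator functions of the descent classes. *)
Lemma descent_moduleP A (x : groupRing int W) :
  descent_module S A x <->
  forall w w', descents S A w = descents S A w' -> x w = x w'.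
Proof.
split=> [[c ->] w w' dw | xA].
  rewrite !gr_sumE; apply: eq_bigr => I _.
  by rewrite !ffunE !descent_eltE dw.
(* The coefficient is the value of [x] on the class of [I]; the default 0 occurs only for
   non-admissible [I]. *)
exists (fun I => if [pick v | descents S A v == I] is Some v then x v else 0%R).
apply/ffunP=> w; rewrite gr_sumE (bigD1 (descents S A w)) ?imset_f //=.
rewrite big1 => [|I /andP[_ /negPf nI]].
  rewrite ffunE descent_eltE eqxx mulr1 addr0.
  by case: pickP => [v /eqP/xA | /(_ w)/eqP].
by rewrite ffunE descent_eltE eq_sym nI mulr0.
Qed.

End Cocycle.

Theorem theoremA (W : finGroupType) (S : coxeterSystem W) (A : {set W}) :
  A \subset reflections S ->
  (exists S1 S2 : {set W},
     [/\ S1 \subset cox_gens S, S2 \subset cox_gens S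
       & A = S1 :|: \bigcup_(s in S2) (s ^: [set: W])%g]) ->
  is_subalgebra (descent_module S A).
Proof.
move=> sAT [S1 [S2 [sS1 _ defA]]]; have [N [NM NS]] := inversion_cocycle S.
split=> [|a x y /descent_moduleP xA /descent_moduleP yA
         |x y /descent_moduleP xA /descent_moduleP yA]; apply/descent_moduleP.
- by move=> w w' _; rewrite !ffunE.
- by move=> w w' dw; rewrite !ffunE (xA _ _ dw) (yA _ _ dw).
apply: (descents_ind NM NS sAT) => [//|s g g' sS sgA <-].
have dS := descents_gen_mul NM NS sAT.
(* [sigma] maps the left factor of [g] to that of [s * g]; the right factor is then forced. *)
pose sigma h := if s ^ h \in A then h else s * h.
have sV : s ^ s = s by rewrite conjgE mulKg.
(* Since [s ^ (s * h) = s ^ h], [h] and [sigma h] fall under the same case. *)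
have sigmaK : involutive sigma.
  move=> h; rewrite /sigma; have [shA | shA] := boolP (s ^ h \in A).
    by rewrite shA.
  by rewrite conjgM sV (negPf shA) mulgA -{1}(cox_gensV sS) mulVg mul1g.
rewrite [LHS]ffunE [RHS]ffunE [RHS](reindex_inj (inv_inj sigmaK)).
apply: eq_bigr => h _; rewrite /sigma; case: ifPn => shA; last first.
  by rewrite (xA (s * h) h) ?dS // invMg -!mulgA mulKg.
congr (_ * _)%R; have -> : h^-1 * (s * g) = s ^ h * (h^-1 * g).
  by rewrite conjgE -!mulgA mulKVg.
have shgE : (s ^ h) ^ (h^-1 * g) = s ^ g by rewrite -conjgM mulKVg.
apply/esym/yA/dS; last by rewrite shgE.
(* If [s ^ h] lay in the class of some [r] in [S2], so would its conjugate [s ^ g], against [sgA];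
   hence it lies in [S1] and is simple. *)
move: shA; rewrite {1}defA in_setU => /orP[/(subsetP sS1) // | /bigcupP[r rS2 shr]].
case/negP: sgA; rewrite defA in_setU; apply/orP; right.
apply/bigcupP; exists r => //.
rewrite -shgE; case/imsetP: shr => u _ ->; rewrite -conjgM.
by apply: imset_f; rewrite inE.
Qed.
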